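(* Let $\mu$ be a positive finite Borel measure on $[0,1)$, let $\gamma>0$ and $\delta\in(-\gamma,1-\gamma)$. The following are equivalent: (i) $I_\mu$ is a well defined continuous operator from $H^\infty_{v_\gamma}$ into $H^\infty_{v_{\gamma+\delta}}$; (ii) $I_\mu$ is a well defined continuous operator from $H^0_{v_\gamma}$ into $H^0_{v_{\gamma+\delta}}$, and $1/v_\gamma\in L_1([0,1),\mu)$; (iii) $\mu$ is a $(1-\delta)$-Carleson measure; (iv) $\mu_n=O\left(\frac{1}{n^{1-\delta}}\right)$ as $n\to\infty$.
   Context: $\mathbb{D}$ is the open unit disc and $H(\mathbb{D})$ the space of holomorphic functions on $\mathbb{D}$. For a positive finite Borel measure $\mu$ on $[0,1)$, $\mu_n=\int_0^1 t^n\,d\mu(t)$ ($n\ge 0$) are its moments, and $I_\mu(f)(z)=\int_0^1\frac{f(t)}{1-tz}\,d\mu(t)$ for $f\in H(\mathbb{D})$ whenever this defines a holomorphic function on $\mathbb{D}$. For $\gamma>0$, $v_\gamma(z)=(1-|z|)^\gamma$; $H^\infty_{v}=\{f\in H(\mathbb{D}):\|f\|_v:=\sup_{z\in\mathbb{D}}v(z)|f(z)|<\infty\}$ and $H^0_v=\{f\in H^\infty_v:\lim_{|z|\to1^-}v(z)|f(z)|=0\}$, both Banach spaces with norm $\|\cdot\|_v$. For $s>0$, $\mu$ is an $s$-Carleson measure if $\mu([t,1))=O((1-t)^s)$ as $t\to1^-$. *)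

(* Defs.v *)
From HB Require Import structures.
From mathcomp Require Import all_boot all_order all_algebra.
From mathcomp Require Import all_classical all_reals all_analysis.
From mathcomp Require Import complex.

Set Implicit Arguments.
Unset Strict Implicit.
Unset Printing Implicit Defensive.

Import Order.TTheory GRing.Theory Num.Theory.
Import numFieldNormedType.Exports.
Local Open Scope classical_set_scope.
Local Open Scope ring_scope.

Section Defs.
Variable R : realType.
Local Notation C := (R[i]).

Definition cmod (z : C) : R := complex.ComplexField.Normc.normc z.

Definition disc : set C := [set z | cmod z < 1].

(* holomorphic on the unit disc: complex differentiable at every point of D
   (derivable over the scalar field C, i.e. the difference quotient
   (f (z + h) - f z) / h converges as h -> 0 in C) *)
Definition holo (f : C -> C) : Prop := forall z, disc z -> derivable (f : C^o -> C^o) z 1.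

Definition vw (gamma : R) (z : C) : R := (1 - cmod z) `^ gamma.

Definition wnorm (gamma : R) (f : C -> C) : R :=
  sup [set vw gamma z * cmod (f z) | z in disc].

Definition Hinf (gamma : R) (f : C -> C) : Prop :=
  holo f /\ exists M : R, forall z, disc z -> vw gamma z * cmod (f z) <= M.

Definition H0 (gamma : R) (f : C -> C) : Prop :=
  Hinf gamma f /\
  forall eps : R, 0 < eps -> exists r : R, r < 1 /\
    forall z, disc z -> r < cmod z -> vw gamma z * cmod (f z) < eps.

Definition integrand (f : C -> C) (z : C) (t : R) : C :=
  f (t%:C)%C / (1 - (t%:C)%C * z).

Definition cintegrable (mu : {measure set R -> \bar R}) (g : R -> C) : Prop :=
  mu.-integrable `[0, 1[ (EFin \o (fun t => complex.Re (g t))) /\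
  mu.-integrable `[0, 1[ (EFin \o (fun t => complex.Im (g t))).

Definition cintegral (mu : {measure set R -> \bar R}) (g : R -> C) : C :=
  ((\int[mu]_(t in `[0, 1[) (complex.Re (g t)))%R
   +i* (\int[mu]_(t in `[0, 1[) (complex.Im (g t)))%R)%C.

Definition Imu (mu : {measure set R -> \bar R}) (f : C -> C) : C -> C :=
  fun z => cintegral mu (integrand f z).

Definition wd_cont_op (mu : {measure set R -> \bar R})
    (X : R -> (C -> C) -> Prop) (g1 : R) (Y : R -> (C -> C) -> Prop) (g2 : R)
  : Prop :=
  (forall f, X g1 f ->
     (forall z, disc z -> cintegrable mu (integrand f z)) /\ Y g2 (Imu mu f))
  /\
  (forall f, X g1 f -> forall eps : R, 0 < eps -> exists eta : R, 0 < eta /\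
     forall g, X g1 g -> wnorm g1 (g \- f) < eta ->
       wnorm g2 (Imu mu g \- Imu mu f) < eps).

Definition carleson (mu : {measure set R -> \bar R}) (s : R) : Prop :=
  exists K : R, exists t0 : R, t0 < 1 /\
    forall t : R, t0 <= t -> t < 1 -> (mu `[t, 1%R[%classic <= (K * (1 - t) `^ s)%:E)%E.

Definition moment (mu : {measure set R -> \bar R}) (n : nat) : \bar R :=
  (\int[mu]_(t in `[0%R, 1%R[) (t ^+ n)%:E)%E.

End Defs.

(* Main.v *)
(** Put [s = 1 - delta], so that [gamma < s < gamma + 1].  If [mu] is
    [s]-Carleson, cutting [[0, 1)] into dyadic layers of [1 - t] turns integrals
    of powers of [1 - t] into geometric series: [(1 - t)^(-a)] integrates to
    [O((1 - r)^(s - a))] over [[r, 1)] when [a < s] and over [[0, r)] when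
    [a > s].  Bounding [1 - t r] below by [1 - r] on the former interval and by
    [1 - t] on the latter gives
    [int (1 - t)^(-gamma) / (1 - t r) dmu = O((1 - r)^(-(gamma + delta)))],
    hence the operator bounds; with [t^n <= (p / (n (1 - t)))^p] and
    [r = 1 - 1/n] the same estimates bound the moments.  Conversely,
    [t^n >= 1/2] for [n] about [1 / (2 (1 - t))] recovers the Carleson condition
    from the moments, and evaluating [I_mu f_a] at [a] for the bounded family
    [f_a(z) = (1 - a)^(m - gamma) / (1 - a z)^m], with [m >= gamma] an integer,
    recovers it from continuity at [0]. *)

Require Import Defs.
From HB Require Import structures.
From mathcomp Require Import all_boot all_order all_algebra.
From mathcomp Require Import all_classical all_reals all_analysis.
From mathcomp Require Import measurable_realfun complex ring lra.

Import Order.TTheory GRing.Theory Num.Theory.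
Import numFieldNormedType.Exports.
Local Open Scope classical_set_scope.
Local Open Scope ring_scope.

(** * Integrals against a Carleson measure *)

(** At each point a single term of the series of [c k] times the indicator of [A k] already
    dominates [f], so integrating termwise suffices. The sets [A k] may overlap. *)
Lemma ge0_integral_le_nneseries {d : measure_display} {T : measurableType d}
    {R : realType} (mu : {measure set T -> \bar R}) (D : set T)
    (f : T -> \bar R) (A : (set T)^nat) (c : nat -> R) :
  measurable D -> measurable_fun D f -> (forall x, D x -> 0 <= f x)%E ->
  (forall k, measurable (A k)) -> (forall k, 0 <= c k) ->
  (forall x, D x -> exists2 k, A k x & (f x <= (c k)%:E)%E) ->
  (\int[mu]_(x in D) f x <= \sum_(k <oo) ((c k)%:E * mu (A k)))%E.
Proof.
move=> mD mf f0 mA c0 fA.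
pose g k x := ((c k)%:E * (\1_(A k) x)%:E)%E : \bar R.
have g0 k x : (0 <= g k x)%E by rewrite /g mule_ge0// lee_fin.
have mg k : measurable_fun D (g k).
  apply: measurable_funeM; apply/measurable_EFinP.
  exact: (measurable_indic (mA k)).
apply: (@le_trans _ _ (\int[mu]_(x in D) \sum_(k <oo) g k x)%E).
  apply: ge0_le_integral => //.
  - by apply: ge0_emeasurable_sum => // k x _ _; exact: g0.
  - move=> x /fA[k Akx] /le_trans; apply.
    apply: le_trans (nneseries_lim_ge (m := 0) k.+1 _) => //.
    rewrite big_nat_recr//= -[leLHS]add0e; apply: leeD.
      exact: sume_ge0.
    by rewrite /g indicE mem_set// mule1.
rewrite integral_nneseries//; apply: lee_nneseries => [k _ _|k _].
  by apply: integral_ge0.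
rewrite /g ge0_integralZl_EFin//; last by apply/measurable_EFinP; exact: (measurable_indic (mA k)).
apply: lee_wpmul2l; first by rewrite lee_fin.
by rewrite integral_indic//; apply: le_measure; rewrite ?inE//; exact: measurableI.
Qed.

Lemma nneseries_geometric_le {R : realType} (a q : R) :
  0 <= a -> 0 <= q -> q < 1 ->
  (\sum_(k <oo) (a * q ^+ k)%:E <= (a / (1 - q))%:E)%E.
Proof.
move=> a0 q0 q1; apply: lime_le.
  by apply: is_cvg_nneseries => n _ _; rewrite lee_fin mulr_ge0// exprn_ge0.
apply: nearW => n; rewrite sumEFin lee_fin.
have := geometric_seriesE a (z := q); rewrite lt_eqF// => /(_ isT)/(congr1 (@^~ n)).
rewrite /series /geometric /= => ->.
rewrite ler_pM2r ?invr_gt0 ?subr_gt0// ler_piMr// lerBlDr lerDl exprn_ge0//.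
Qed.

Lemma exists_pow2_sandwich {R : realType} (y : R) : 1 <= y ->
  exists k : nat, 2 ^+ k <= y <= 2 * 2 ^+ k.
Proof.
move=> y1; have y0 : 0 <= y by apply: le_trans y1.
have t0 : (0 < Num.trunc y)%N by rewrite Num.Theory.truncn_gt0.
exists (trunc_log 2 (Num.trunc y)).
have /andP[h1 h2] := Num.Theory.truncn_itv y0.
have /andP[] := @trunc_log_bounds 2 _ isT t0.
rewrite -(ler_nat R) natrX => /le_trans/(_ h1) -> /=.
(* Between integers the strict bound gains one: the integer part of [y] plus one, which exceeds [y],
   is at most [2 * 2^k]. *)
rewrite -(ler_nat R) natrX exprS => h3.
by apply/ltW/(lt_le_trans h2).
Qed.

(* Negative [t] are included: the dyadic layers of [carleson_dyadic_integral]
   may start below [0]. *)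
Definition global_carleson {R : realType} (mu : {measure set R -> \bar R})
    (s K : R) :=
  forall t : R, t < 1 -> (mu `[t, 1%R[%classic <= (K * (1 - t) `^ s)%:E)%E.

(** Below the threshold [t0] the finite total mass [M] is at most [M / (1 - t0)^s * (1 - t)^s], so a
    larger constant removes the threshold. *)
Lemma carleson_global {R : realType} (mu : {finite_measure set R -> \bar R})
    (s : R) : 0 < s -> carleson mu s -> exists2 K, 0 <= K & global_carleson mu s K.
Proof.
move=> s0 [K [t0 [t01 hK]]].
have muT : mu setT \is a fin_num by exact: fin_num_measure.
pose M := fine (mu setT); have M0 : 0 <= M by apply: fine_ge0.
have p0 : 0 < (1 - t0) `^ s by rewrite powR_gt0// subr_gt0.
exists (`|K| + M / (1 - t0) `^ s) => [|t t1].
  by rewrite addr_ge0// divr_ge0// powR_ge0.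
have [tt|tt] := leP t0 t.
  apply: (le_trans (hK _ tt t1)); rewrite lee_fin ler_wpM2r ?powR_ge0//.
  apply: le_trans (ler_norm K) _; rewrite lerDl divr_ge0// ltW//.
apply: (@le_trans _ _ (mu setT)); first by apply: le_measure; rewrite ?inE.
rewrite -(fineK muT) lee_fin -/M mulrDl.
rewrite -[leLHS]add0r lerD ?mulr_ge0 ?powR_ge0//.
rewrite mulrAC ler_pdivlMr// ler_wpM2l// ge0_ler_powR ?nnegrE ?subr_ge0 ?ltW//.
by rewrite ltrD2l ltrN2.
Qed.

Lemma measurable_powR_1B {R : realType} (D : set R) (p : R) :
  measurable D -> measurable_fun D (fun t : R => (1 - t) `^ p).
Proof.
move=> mD; apply: (measurableT_comp (measurable_powR p)).
by apply: measurable_funB.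
Qed.

(* Each dyadic layer [l k <= 1 - t <= 2 l k] contributes a multiple of
   [l k `^ (s - a)]. *)
Lemma carleson_dyadic_integral {R : realType} (mu : {measure set R -> \bar R})
    (s K a l q : R) (D : set R) :
  0 <= a -> 0 <= K -> 0 < l -> 0 < q -> q `^ (s - a) < 1 ->
  global_carleson mu s K -> measurable D ->
  (forall t, D t -> t < 1 /\
    exists k : nat, l * q ^+ k <= 1 - t <= 2 * (l * q ^+ k)) ->
  (\int[mu]_(t in D) ((1 - t) `^ (- a))%:E <=
   (K * 2 `^ s * l `^ (s - a) / (1 - q `^ (s - a)))%:E)%E.
Proof.
move=> a0 K0 l0 q0 q1 hmu mD hD.
have lk k : 0 < l * q ^+ k by rewrite mulr_gt0// exprn_gt0.
(* [A k] is the whole tail starting at the left end of the layer, because the Carleson condition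
   bounds tails; [c k] bounds the integrand on the layer. *)
pose A k := `[1 - 2 * (l * q ^+ k), 1[%classic : set R.
pose c k := (l * q ^+ k) `^ (- a).
apply: le_trans (@ge0_integral_le_nneseries _ _ R mu D _ A c mD _ _ _ _ _) _.
- by apply/measurable_EFinP; exact: (measurable_powR_1B _ _ mD).
- by move=> t _; rewrite lee_fin powR_ge0.
- by move=> k; exact: measurable_itv.
- by move=> k; exact: powR_ge0.
- move=> t /hD[t1 [k /andP[k1 k2]]]; exists k.
    by rewrite /A/= in_itv/= t1 andbT lerBlDr -lerBlDl.
  rewrite lee_fin /c !powRN lef_pV2 ?posrE ?powR_gt0// ?subr_gt0//.
  by rewrite ge0_ler_powR// nnegrE ltW// subr_gt0.
have qa0 : 0 <= q `^ (s - a) by exact: powR_ge0.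
apply: le_trans (nneseries_geometric_le (K * 2 `^ s * l `^ (s - a)) _ _ qa0 q1); last first.
  by rewrite !mulr_ge0// powR_ge0.
apply: lee_nneseries => [k _ _|k _].
  by rewrite mule_ge0// lee_fin powR_ge0.
apply: (@le_trans _ _ ((c k)%:E * (K * (2 * (l * q ^+ k)) `^ s)%:E)%E).
  apply: lee_wpmul2l; first by rewrite lee_fin powR_ge0.
  have := hmu (1 - 2 * (l * q ^+ k)); rewrite opprB addrCA subrr addr0; apply.
  by rewrite ltrBlDr ltrDl mulr_gt0.
have e1 : (l * q ^+ k) `^ (s - a) = l `^ (s - a) * (q `^ (s - a)) ^+ k.
  rewrite powRM ?exprn_ge0 ?(ltW l0) ?(ltW q0)// -[in RHS]powR_mulrn//.
  by rewrite -powRrM [_ * k%:R]mulrC powRrM powR_mulrn// ltW.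
have e2 : (l * q ^+ k) `^ (s - a) = (l * q ^+ k) `^ s * (l * q ^+ k) `^ (- a).
  by rewrite -powRD// (gt_eqF (lk k)) implybT.
rewrite -EFinM lee_fin /c (@powRM _ 2) ?(ltW (lk k))// -[leRHS]mulrA -e1 e2.
by rewrite le_eqVlt; apply/predU1P; left; ring.
Qed.

(** Layers shrinking towards 1: [q = 1/2], with [l = (1 - r) / 2] so that the first layer ends at
    [1 - t = 1 - r]. The series has ratio [2^(a - s)], below 1 because [a < s]. *)
Lemma carleson_integral_near1 {R : realType} (mu : {measure set R -> \bar R})
    (s K a : R) : 0 <= a -> a < s -> 0 <= K -> global_carleson mu s K ->
  exists2 C, 0 <= C & forall r, r < 1 ->
    (\int[mu]_(t in `[r, 1%R[) ((1 - t) `^ (- a))%:E <=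
      (C * (1 - r) `^ (s - a))%:E)%E.
Proof.
move=> a0 as_ K0 hmu.
have q1 : (2^-1 : R) `^ (s - a) < 1.
  rewrite -[X in _ < X](congr1 (@^~ (s - a)) (powR1 R)) gt0_ltr_powR ?nnegrE ?subr_gt0//.
  by rewrite invf_lt1// ltr1n.
exists (K * 2 `^ s * 2^-1 `^ (s - a) / (1 - 2^-1 `^ (s - a))) => [|r r1].
  by rewrite !mulr_ge0 ?powR_ge0// invr_ge0 subr_ge0 ltW.
have l0 : 0 < (1 - r) / 2 by rewrite divr_gt0 ?subr_gt0.
apply: le_trans (@carleson_dyadic_integral R mu s K a ((1 - r) / 2) 2^-1
  `[r, 1[%classic a0 K0 l0 _ q1 hmu _ _) _ => //.
- move=> t /=; rewrite in_itv/= => /andP[rt t1]; split=> //.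
  have t0 : 0 < 1 - t by rewrite subr_gt0.
  have [|k /andP[k1 k2]] := @exists_pow2_sandwich R ((1 - r) / (1 - t)).
    by rewrite ler_pdivlMr// mul1r lerB.
  have p2 : 0 < 2 ^+ k :> R by rewrite exprn_gt0.
  exists k; rewrite exprVn; apply/andP; split.
    rewrite ler_pdivrMr// ler_pdivrMr//.
    by rewrite ler_pdivrMr// in k2; apply: le_trans k2 _; rewrite le_eqVlt; apply/predU1P; left; ring.
  rewrite mulrA [2 * _]mulrC divfK ?pnatr_eq0// ler_pdivlMr//.
  by rewrite ler_pdivlMr// mulrC in k1.
- rewrite lee_fin powRM ?invr_ge0// ?subr_ge0 ?(ltW r1)//.
  by rewrite le_eqVlt; apply/predU1P; left; ring.
Qed.

(** Layers growing away from 1: [q = 2] and [l = 1 - r]. The series has ratio [2^(s - b)], below 1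
    because [s < b]. *)
Lemma carleson_integral_away1 {R : realType} (mu : {measure set R -> \bar R})
    (s K b : R) : 0 <= b -> s < b -> 0 <= K -> global_carleson mu s K ->
  exists2 C, 0 <= C & forall r, r < 1 ->
    (\int[mu]_(t in `[0%R, r[) ((1 - t) `^ (- b))%:E <=
      (C * (1 - r) `^ (s - b))%:E)%E.
Proof.
move=> b0 sb K0 hmu.
have q1 : (2 : R) `^ (s - b) < 1.
  rewrite -opprB powRN invf_lt1 ?powR_gt0//.
  by rewrite -[X in X < _](congr1 (@^~ (b - s)) (powR1 R)) gt0_ltr_powR ?nnegrE ?subr_gt0// ltr1n.
exists (K * 2 `^ s / (1 - 2 `^ (s - b))) => [|r r1].
  by rewrite !mulr_ge0 ?powR_ge0// invr_ge0 subr_ge0 ltW.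
have l0 : 0 < 1 - r by rewrite subr_gt0.
apply: le_trans (@carleson_dyadic_integral R mu s K b (1 - r) 2
  `[0, r[%classic b0 K0 l0 _ q1 hmu _ _) _ => //.
- move=> t /=; rewrite in_itv/= => /andP[t0 tr]; split; first exact: lt_trans r1.
  have [|k /andP[k1 k2]] := @exists_pow2_sandwich R ((1 - t) / (1 - r)).
    by rewrite ler_pdivlMr// mul1r lerB// ltW.
  exists k; apply/andP; split; first by rewrite ler_pdivlMr// mulrC in k1.
  by rewrite ler_pdivrMr// in k2; apply: le_trans k2 _; rewrite le_eqVlt; apply/predU1P; left; ring.
- by rewrite lee_fin; rewrite le_eqVlt; apply/predU1P; left; ring.
Qed.

(** A form of Markov's inequality; both lower bounds, for moments and for test functions, rest on
    it. *)
Lemma ge0_integral_ge_cst {d : measure_display} {T : measurableType d}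
    {R : realType} (mu : {measure set T -> \bar R}) (D A : set T)
    (f : T -> \bar R) (c : R) :
  measurable D -> measurable A -> A `<=` D -> measurable_fun D f ->
  (forall x, D x -> 0 <= f x)%E -> 0 <= c ->
  (forall x, A x -> c%:E <= f x)%E ->
  (c%:E * mu A <= \int[mu]_(x in D) f x)%E.
Proof.
move=> mD mA AD mf f0 c0 cf.
rewrite -(integral_cst mu mA c%:E).
apply: (@le_trans _ _ (\int[mu]_(x in A) f x)%E).
  by apply: ge0_le_integral => //; apply: measurable_funS mf.
exact: ge0_subset_integral.
Qed.

Lemma ge0_integral_split01 {R : realType} (mu : {measure set R -> \bar R})
    (r : R) (f : R -> \bar R) : 0 <= r -> r < 1 ->
  measurable_fun (`[0, 1[%classic : set R) f ->
  (forall x, 0 <= x -> x < 1 -> (0 <= f x)%E) ->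
  (\int[mu]_(t in `[0%R, 1%R[) f t =
   \int[mu]_(t in `[0%R, r[) f t + \int[mu]_(t in `[r, 1%R[) f t)%E.
Proof.
move=> r0 r1 mf f0.
have e : `[0, 1[%classic = `[0, r[%classic `|` `[r, 1[%classic :> set R.
  by rewrite -itv_bndbnd_setU// bnd_simp// ltW.
rewrite e ge0_integral_setU//.
- by rewrite -e.
- by move=> x; rewrite -e /= in_itv/= => /andP[]; exact: f0.
- apply/disj_setPS => x /= []; rewrite !in_itv/= => /andP[_ xr] /andP[rx _].
  by move: xr; rewrite ltNge rx.
Qed.

Lemma measurable_powR_kernel {R : realType} (D : set R) (g r : R) :
  measurable D ->
  measurable_fun D (fun t : R => (1 - t) `^ (- g) * (1 - t * r) `^ (- 1)).
Proof.
move=> mD; apply: measurable_funM; first exact: measurable_powR_1B.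
apply: (measurableT_comp (measurable_powR (- 1))).
by apply: measurable_funB => //; apply: measurable_funM.
Qed.

(** Splitting at [r] leaves the exponent [g + 1 > s] on [[0, r)] and [g < s] on [[r, 1)], so each
    piece falls under one of the two estimates, and both have order [s - g - 1] in [1 - r]. *)
Lemma carleson_kernel_integral {R : realType} (mu : {measure set R -> \bar R})
    (s K g : R) : 0 <= g -> g < s -> s < g + 1 -> 0 <= K ->
  global_carleson mu s K ->
  exists2 C, 0 <= C & forall r, 0 <= r -> r < 1 ->
    (\int[mu]_(t in `[0%R, 1%R[) ((1 - t) `^ (- g) * (1 - t * r) `^ (- 1))%:E <=
      (C * (1 - r) `^ (s - g - 1))%:E)%E.
Proof.
move=> g0 gs sg K0 hmu.
have [C1 C10 h1] := carleson_integral_near1 mu s K g g0 gs K0 hmu.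
have [C2 C20 h2] := carleson_integral_away1 mu s K (g + 1)
  (addr_ge0 g0 ler01) sg K0 hmu.
exists (C2 + C1) => [|r r0 r1]; first exact: addr_ge0.
have mk := @measurable_powR_kernel R _ g r.
have k0 (t : R) : (0 <= ((1 - t) `^ (- g) * (1 - t * r) `^ (- 1))%:E)%E.
  by rewrite lee_fin mulr_ge0// powR_ge0.
have r10 : 0 < 1 - r by rewrite subr_gt0.
rewrite (ge0_integral_split01 mu r)//; last first.
  by apply/measurable_EFinP; exact: mk.
rewrite mulrDl EFinD; apply: leeD.
  rewrite (_ : s - g - 1 = s - (g + 1)); last by ring.
  apply: le_trans (h2 r r1); apply: ge0_le_integral => //.
  - by apply/measurable_EFinP; exact: mk.
  - by apply/measurable_EFinP; exact: measurable_powR_1B.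
  - move=> t /=; rewrite in_itv/= => /andP[t0 tr]; rewrite lee_fin.
    have t1 : 0 < 1 - t by rewrite subr_gt0 (lt_trans tr).
    rewrite [- (g + 1)]opprD powRD ?(gt_eqF t1) ?implybT// ler_wpM2l ?powR_ge0//.
    have tr1 : 1 - t <= 1 - t * r by rewrite lerB// ler_piMr// ltW.
    by rewrite !powR_inv1 ?lef_pV2 ?posrE ?(ltW t1)// ?(lt_le_trans t1)// (le_trans (ltW t1)).
apply: (@le_trans _ _ (((1 - r) `^ (- 1))%:E * (C1 * (1 - r) `^ (s - g))%:E)%E); last first.
  rewrite -EFinM lee_fin [in leRHS]powRD ?(gt_eqF r10) ?implybT//.
  by rewrite le_eqVlt; apply/predU1P; left; ring.
apply: (@le_trans _ _ (((1 - r) `^ (- 1))%:E *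
   \int[mu]_(t in `[r, 1%R[) ((1 - t) `^ (- g))%:E)%E); last first.
  by apply: lee_wpmul2l; rewrite ?lee_fin ?powR_ge0//; exact: h1.
rewrite -ge0_integralZl_EFin ?powR_ge0//; last first.
- by apply/measurable_EFinP; exact: measurable_powR_1B.
- by move=> t _; rewrite lee_fin powR_ge0.
apply: ge0_le_integral => //.
- by apply/measurable_EFinP; exact: mk.
- apply: measurable_funeM.
  by apply/measurable_EFinP; exact: measurable_powR_1B.
move=> t /=; rewrite in_itv/= => /andP[rt t1].
rewrite -EFinM lee_fin mulrC ler_wpM2r ?powR_ge0//.
have tr1 : 1 - r <= 1 - t * r by rewrite lerB// ler_piMl// ltW.
by rewrite !powR_inv1 ?lef_pV2 ?posrE ?(ltW r10)// ?(lt_le_trans r10)// (le_trans (ltW r10)).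
Qed.

(** * Moments and the Carleson condition *)

Lemma measurable_expn {R : realType} (D : set R) (n : nat) :
  measurable D -> measurable_fun D (fun t : R => (t ^+ n)%:E).
Proof. by move=> mD; apply/measurable_EFinP; exact: measurable_funX. Qed.

Lemma powR_invl {R : realType} (x p : R) : 0 <= x -> x^-1 `^ p = x `^ (- p).
Proof. by move=> x0; rewrite -(powR_inv1 x0) -powRrM mulN1r. Qed.

(** With [x = n (1 - t) / p], [t <= exp (t - 1)] gives [t^n <= exp (- x p)], and [x <= exp x] gives
    [x^p <= exp (x p)]; the product is at most 1. *)
Lemma expn_le_powR_1B {R : realType} (p t : R) (n : nat) :
  0 < p -> 0 <= t -> t < 1 -> (0 < n)%N ->
  t ^+ n <= (p / n%:R) `^ p * (1 - t) `^ (- p).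
Proof.
move=> p0 t0 t1 n0.
have t10 : 0 < 1 - t by rewrite subr_gt0.
have n0' : 0 < n%:R :> R by rewrite ltr0n.
pose x := n%:R * (1 - t) / p; have x0 : 0 < x by rewrite divr_gt0// mulr_gt0.
have -> : (p / n%:R) `^ p * (1 - t) `^ (- p) = (x `^ p)^-1.
  rewrite -powRN -!powR_invl ?(ltW x0) ?(ltW t10)//.
  rewrite -powRM ?invr_ge0 ?divr_ge0 ?(ltW t10) ?(ltW p0)//.
  by rewrite /x invf_div invfM mulrA.
rewrite -[leRHS]mul1r ler_pdivlMr ?powR_gt0//.
apply: (@le_trans _ _ (expR (- x * p) * expR (x * p))); last first.
  by rewrite -expRD mulNr addNr expR0.
apply: ler_pM; rewrite ?exprn_ge0 ?powR_ge0//.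
  rewrite mulNr /x divfK ?gt_eqF// -mulrN opprB expRM_natl lerXn2r ?nnegrE ?expR_ge0//.
  by apply: le_trans (expR_ge1Dx _); rewrite addrC subrK.
rewrite expRM ge0_ler_powR ?nnegrE ?(ltW p0) ?(ltW x0) ?expR_ge0//.
by apply: le_trans (expR_ge1Dx _); rewrite lerDr.
Qed.

Lemma carleson_moment {R : realType} (mu : {finite_measure set R -> \bar R})
    (s : R) : 0 < s -> carleson mu s ->
  exists K : R, exists N : nat, forall n : nat, (N <= n)%N ->
    (`|moment mu n| <= (K / (n%:R `^ s))%:E)%E.
Proof.
move=> s0 /(carleson_global mu s s0)[K K0 hmu].
(* Any exponent above [s] would make the estimate away from 1 applicable. *)
pose p := s + 1; have p0 : 0 < p by rewrite addr_gt0.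
have sp : s < p by rewrite ltrDl.
have [C C0 hC] := carleson_integral_away1 mu s K p (ltW p0) sp K0 hmu.
exists (C * p `^ p + K), 1%N => n n0.
have n0' : 0 < n%:R :> R by rewrite ltr0n.
have tn0 (t : R) : 0 <= t -> t < 1 -> (0 <= (t ^+ n)%:E)%E.
  by move=> t0 _; rewrite lee_fin exprn_ge0.
rewrite gee0_abs; last first.
  by apply: integral_ge0 => t /=; rewrite in_itv/= => /andP[]; exact: tn0.
(* With [1 - r = 1/n] both pieces have order [n^(-s)]: below [r] by the power bound on [t^n], above
   [r] by [t^n <= 1] and the tail bound. *)
pose r : R := 1 - n%:R^-1.
have r0 : 0 <= r by rewrite subr_ge0 invf_le1// ler1n.
have r1 : r < 1 by rewrite ltrBlDr ltrDl invr_gt0.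
have er : 1 - r = n%:R^-1 by rewrite /r opprB addrCA subrr addr0.
rewrite /moment (ge0_integral_split01 mu r)//; last exact: measurable_expn.
rewrite mulrDl EFinD; apply: leeD.
  apply: (@le_trans _ _ (((p / n%:R) `^ p)%:E *
      \int[mu]_(t in `[0%R, r[) ((1 - t) `^ (- p))%:E)%E).
    rewrite -ge0_integralZl_EFin ?powR_ge0//; last first.
    - by apply/measurable_EFinP; exact: measurable_powR_1B.
    - by move=> t _; rewrite lee_fin powR_ge0.
    apply: ge0_le_integral => //.
    - by move=> t /=; rewrite in_itv/= => /andP[t0 _]; rewrite lee_fin exprn_ge0.
    - exact: measurable_expn.
    - apply: measurable_funeM.
      by apply/measurable_EFinP; exact: measurable_powR_1B.
    move=> t /=; rewrite in_itv/= => /andP[t0 tr].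
    by rewrite -EFinM lee_fin expn_le_powR_1B// (lt_trans tr).
  apply: (@le_trans _ _ (((p / n%:R) `^ p)%:E * (C * (1 - r) `^ (s - p))%:E)%E).
    by apply: lee_wpmul2l; rewrite ?lee_fin ?powR_ge0//; exact: hC.
  have nv : 0 < n%:R^-1 :> R by rewrite invr_gt0.
  rewrite er -EFinM lee_fin powRD ?(gt_eqF nv) ?implybT//.
  rewrite powRM ?invr_ge0 ?(ltW p0) ?(ltW n0')//.
  have e1 : n%:R^-1 `^ p * n%:R^-1 `^ (- p) = 1 :> R.
    by rewrite powRN divff// gt_eqF// powR_gt0// invr_gt0.
  have e2 : n%:R^-1 `^ s = (n%:R `^ s)^-1 :> R.
    by rewrite powR_invl ?powRN// ltW.
  rewrite -e2 le_eqVlt; apply/predU1P; left.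
  rewrite [LHS](_ : _ = C * p `^ p * n%:R^-1 `^ s * (n%:R^-1 `^ p * n%:R^-1 `^ (- p))); last by ring.
  by rewrite e1 mulr1.
apply: (@le_trans _ _ (\int[mu]_(t in `[r, 1%R[) (cst (1%:E : \bar R)) t)%E).
  apply: ge0_le_integral => //.
  - move=> t /=; rewrite in_itv/= => /andP[rt _].
    by rewrite lee_fin exprn_ge0// (le_trans r0).
  - exact: measurable_expn.
  move=> t /=; rewrite in_itv/= => /andP[rt t1].
  by rewrite lee_fin exprn_ile1// ?(le_trans r0)// ltW.
rewrite integral_cst// mul1e; apply: le_trans (hmu r r1) _.
by rewrite er lee_fin powR_invl ?powRN// ltW.
Qed.

(** Bernoulli's inequality in terms of [1 - x]; the induction step loses exactly [n (1 - x)^2]. *)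
Lemma bernoulli_1B {R : realDomainType} (x : R) (n : nat) :
  0 <= x -> x <= 1 -> 1 - n%:R * (1 - x) <= x ^+ n.
Proof.
move=> x0 x1; elim: n => [|n IH]; first by rewrite mul0r subr0 expr0.
rewrite exprS; apply: le_trans (ler_wpM2l x0 IH).
rewrite -subr_ge0 -natr1.
rewrite (_ : _ - _ = n%:R * ((1 - x) * (1 - x))); last by ring.
by rewrite mulr_ge0// mulr_ge0// subr_ge0.
Qed.

Lemma moment_carleson {R : realType} (mu : {finite_measure set R -> \bar R})
    (s : R) : 0 < s ->
  (exists K : R, exists N : nat, forall n : nat, (N <= n)%N ->
    (`|moment mu n| <= (K / (n%:R `^ s))%:E)%E) -> carleson mu s.
Proof.
move=> s0 [K [N hK]].
(* For [t >= t0] the number [u] below is at least [N + 1], so that its integer part [n] lies in the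
   range of the moment bound. *)
pose t0 : R := 1 - (2 * N.+1%:R)^-1.
have N0 : 0 < N.+1%:R :> R by rewrite ltr0n.
have p2 : 0 < 2 * N.+1%:R :> R by rewrite mulr_gt0.
have t00 : 0 <= t0.
  by rewrite subr_ge0 invf_le1// -natrM ler1n.
(* The factor 2 comes from [t^n >= 1/2], and [4^s] from [1/n <= 4 (1 - t)], which follows from
   [u < n + 1 <= 2 n]. *)
exists (2 * `|K| * 4 `^ s), t0; split => [|t tt0 t1].
  by rewrite ltrBlDr ltrDl invr_gt0.
have t10 : 0 < 1 - t by rewrite subr_gt0.
have tge0 : 0 <= t by exact: le_trans tt0.
pose u := (2 * (1 - t))^-1.
have u0 : 0 < u by rewrite invr_gt0 mulr_gt0.
have uN : N.+1%:R <= u.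
  rewrite -[leLHS]invrK lef_pV2 ?posrE ?invr_gt0// ?mulr_gt0//.
  move: tt0; rewrite /t0 lerBlDr -lerBlDl invfM => h.
  rewrite -ler_pdivlMl//.
pose n := Num.trunc u.
have /andP[nu un] := Num.Theory.truncn_itv (ltW u0).
rewrite -/n in nu un.
have Nn : (N < n)%N by rewrite Num.Theory.truncn_ge_nat// ltW.
have n0 : 0 < n%:R :> R by rewrite ltr0n (leq_ltn_trans _ Nn).
have nt : n%:R * (1 - t) <= 2^-1.
  rewrite -ler_pdivlMr//; apply: le_trans nu _.
  by rewrite /u invfM.
have lb : ((2^-1)%:E * mu `[t, 1%R[%classic <= moment mu n)%E.
  apply: ge0_integral_ge_cst => //.
  - by move=> x /=; rewrite !in_itv/= => /andP[tx ->]; rewrite (le_trans tge0).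
  - exact: measurable_expn.
  - by move=> x /=; rewrite in_itv/= => /andP[x0 _]; rewrite lee_fin exprn_ge0.
  move=> x /=; rewrite in_itv/= => /andP[tx x1]; rewrite lee_fin.
  apply: le_trans (@bernoulli_1B R x n (le_trans tge0 tx) (ltW x1)).
  have : n%:R * (1 - x) <= n%:R * (1 - t) by rewrite ler_pM2l// lerB.
  lra.
have ub : (moment mu n <= (`|K| * (4 * (1 - t)) `^ s)%:E)%E.
  apply: le_trans (lee_abs _) _; apply: le_trans (hK n (ltnW Nn)) _.
  rewrite lee_fin; apply: (@le_trans _ _ (`|K| / n%:R `^ s)).
    by rewrite ler_wpM2r ?invr_ge0 ?powR_ge0// ler_norm.
  rewrite ler_wpM2l// -powRN -mulN1r powRrM powR_inv1 ?(ltW n0)//.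
  rewrite ge0_ler_powR ?nnegrE ?invr_ge0 ?mulr_ge0 ?(ltW s0) ?(ltW n0) ?(ltW t10)//.
  rewrite -(ler_pM2l n0) mulfV ?gt_eqF//.
  move: un; rewrite /u -[X in X < _]mul1r ltr_pdivrMr ?mulr_gt0// -natr1 => un.
  have n1 : 1 <= n%:R :> R by rewrite ler1n -(ltr_nat R).
  have : (1 - t) * 1 <= (1 - t) * n%:R by rewrite ler_wpM2l// ltW.
  lra.
have := le_trans lb ub.
rewrite lee_pdivrMl// => /le_trans; apply.
rewrite -EFinM lee_fin powRM ?(ltW t10)//.
by rewrite le_eqVlt; apply/predU1P; left; ring.
Qed.

(** * Holomorphic functions of one complex variable *)

Lemma normr_cmod {R : realType} (z : R[i]) : `|z| = (cmod z)%:C%C.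
Proof. by rewrite normc_def; case: z. Qed.

Lemma cmod_ge0 {R : realType} (z : R[i]) : 0 <= cmod z.
Proof. by rewrite -ler0c -normr_cmod. Qed.

Lemma cmodM {R : realType} (z w : R[i]) : cmod (z * w) = cmod z * cmod w.
Proof. exact: complex.ComplexField.Normc.normcM. Qed.

Lemma cmodV {R : realType} (z : R[i]) : cmod z^-1 = (cmod z)^-1.
Proof. exact: complex.ComplexField.Normc.normcV. Qed.

Lemma cmodX {R : realType} (z : R[i]) n : cmod (z ^+ n) = cmod z ^+ n.
Proof.
by apply: complexI; rewrite -normr_cmod normrX normr_cmod rmorphXn.
Qed.

Lemma cmodD {R : realType} (z w : R[i]) : cmod (z + w) <= cmod z + cmod w.
Proof. exact: le_normcD. Qed.

Lemma cmodN {R : realType} (z : R[i]) : cmod (- z) = cmod z.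
Proof. exact: normcN. Qed.

Lemma cmodB {R : realType} (z w : R[i]) : cmod z - cmod w <= cmod (z - w).
Proof. by rewrite lerBlDr (le_trans _ (cmodD _ _))// subrK. Qed.

Lemma cmod_real {R : realType} (t : R) : cmod t%:C%C = `|t|.
Proof. by rewrite /cmod /= expr0n/= addr0 sqrtr_sqr. Qed.

Lemma cmod0 {R : realType} : cmod (0 : R[i]) = 0.
Proof. exact: complex.ComplexField.Normc.normc0. Qed.

Lemma cmod1 {R : realType} : cmod (1 : R[i]) = 1.
Proof. exact: complex.ComplexField.Normc.normc1. Qed.

Lemma cmod_eq0 {R : realType} (z : R[i]) : (cmod z == 0) = (z == 0).
Proof.
apply/eqP/eqP => [|->]; last exact: cmod0.
exact: complex.ComplexField.Normc.eq0_normc.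
Qed.

Lemma Re_le_cmod {R : realType} (z : R[i]) : `|complex.Re z| <= cmod z.
Proof. by have := normc_ge_Re z; rewrite normr_cmod lecR. Qed.

Lemma Im_le_cmod {R : realType} (z : R[i]) : `|complex.Im z| <= cmod z.
Proof.
case: z => a b; rewrite /cmod /= -sqrtr_sqr ler_wsqrtr// lerDr.
exact: sqr_ge0.
Qed.

Lemma cmod_le_ReIm {R : realType} (z : R[i]) :
  cmod z <= `|complex.Re z| + `|complex.Im z|.
Proof.
case: z => a b; rewrite /cmod /= -[leRHS]ger0_norm ?addr_ge0// -sqrtr_sqr.
rewrite ler_wsqrtr// -(real_normK (num_real a)) -(real_normK (num_real b)).
by rewrite sqrrD -addrA lerD2l lerDr mulrn_wge0// mulr_ge0.
Qed.

Lemma cmod_1Btz_ge {R : realType} (t : R) (z : R[i]) : 0 <= t ->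
  1 - t * cmod z <= cmod (1 - t%:C%C * z).
Proof.
move=> t0; apply: le_trans (cmodB _ _).
by rewrite cmod1 cmodM cmod_real ger0_norm.
Qed.

(** A linear rate of convergence for the difference quotient, stated with real moduli, is what the
    explicit computation for [Imu] delivers. *)
Lemma derivable_of_quotient_bound {R : realType} (F : R[i] -> R[i])
    (z G : R[i]) (M d : R) : 0 < d -> 0 <= M ->
  (forall h, h != 0 -> cmod h < d ->
     cmod (h^-1 * (F (h + z) - F z) - G) <= M * cmod h) ->
  derivable (F : R[i]^o -> R[i]^o) z 1.
Proof.
move=> d0 M0 hF; apply/cvg_ex; exists (G : R[i]^o).
apply/cvgrPdist_lt => eps eps0.
(* A positive element of [R[i]] is real, so [eps] can be traded for a real [e]. *)
have /complex_realP[e ee] : eps \is Num.real by rewrite gtr0_real.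
rewrite ee ltcR in eps0.
(* The denominator [M + 1] stays positive when [M = 0]. *)
have m0 : 0 < Num.min d (e / (M + 1)).
  by rewrite lt_min d0 divr_gt0// ltr_wpDl.
near=> h.
have h0 : h != 0 by near: h; exact: nbhs_dnbhs_neq.
have hm : cmod h < Num.min d (e / (M + 1)).
  have : `|h| < (Num.min d (e / (M + 1)))%:C%C.
    near: h; apply: dnbhs0_lt; rewrite ltcR//.
  by rewrite normr_cmod ltcR.
move: hm; rewrite lt_min => /andP[hd he].
rewrite /= distrC ee normr_cmod ltcR.
rewrite /GRing.scale /= mulr1.
apply: (le_lt_trans (hF h h0 hd)).
move: he; rewrite ltr_pdivlMr ?ltr_wpDl// => he.
apply: le_lt_trans he; rewrite mulrC ler_wpM2l ?cmod_ge0//.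
by rewrite lerDl.
Unshelve. all: by end_near.
Qed.

Lemma holo_continuous {R : realType} (f : R[i] -> R[i]) (z : R[i]) :
  holo f -> disc z -> {for z, continuous (f : R[i]^o -> R[i]^o)}.
Proof.
move=> hf dz; apply: differentiable_continuous.
by apply/derivable1_diffP; exact: hf.
Qed.

(** [p] stands for the real or the imaginary part; being 1-Lipschitz is all they need to share. *)
Lemma holo_continuous_real {R : realType} (f : R[i] -> R[i]) (p : R[i] -> R)
    (t : R) : (forall z w, `|p z - p w| <= cmod (z - w)) ->
  holo f -> `|t| < 1 -> {for t, continuous (fun t : R => p (f t%:C%C))}.
Proof.
move=> hp hf t1; apply/cvgrPdist_lt => eps eps0.
have dt : disc t%:C%C by rewrite /disc /mkset cmod_real.
have /cvgrPdist_lt/(_ eps%:C%C) := holo_continuous _ _ hf dt.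
rewrite ltcR => /(_ eps0) /nbhs_ballP[d d0 hd].
have /complex_realP[e ee] : d \is Num.real by rewrite gtr0_real.
have e0 : 0 < e by move: d0; rewrite /= ee ltcR.
near=> x.
apply: le_lt_trans (hp _ _) _.
rewrite -ltcR -normr_cmod; apply: hd.
rewrite /ball /= ee -rmorphB normr_cmod ltcR cmod_real.
near: x; apply/nbhs_ballP; exists e => // y; rewrite /ball/=.
Unshelve. all: by end_near.
Qed.

(** * Complex-valued integrals *)

(** Taken by components, to match [cintegrable]. *)
Definition cmeasurable_fun {R : realType} (D : set R) (g : R -> R[i]) :=
  measurable_fun D (fun t => complex.Re (g t)) /\
  measurable_fun D (fun t => complex.Im (g t)).

Lemma cmeasurable_real {R : realType} (D : set R) (g : R -> R) :
  measurable_fun D g -> cmeasurable_fun D (fun t => (g t)%:C%C).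
Proof. by move=> mg; split => //=. Qed.

Lemma cmeasurable_cst {R : realType} (D : set R) (c : R[i]) :
  cmeasurable_fun D (fun=> c).
Proof. by split. Qed.

Lemma cmeasurableB {R : realType} (D : set R) (g h : R -> R[i]) :
  cmeasurable_fun D g -> cmeasurable_fun D h ->
  cmeasurable_fun D (fun t => g t - h t).
Proof.
move=> [g1 g2] [h1 h2]; split.
  rewrite (_ : (fun _ => _) = (fun t => complex.Re (g t) - complex.Re (h t))).
    exact: measurable_funB.
  by apply/funext => t; case: (g t) => ? ?; case: (h t).
rewrite (_ : (fun _ => _) = (fun t => complex.Im (g t) - complex.Im (h t))).
  exact: measurable_funB.
by apply/funext => t; case: (g t) => ? ?; case: (h t).
Qed.

Lemma cmeasurableM {R : realType} (D : set R) (g h : R -> R[i]) :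
  cmeasurable_fun D g -> cmeasurable_fun D h ->
  cmeasurable_fun D (fun t => g t * h t).
Proof.
move=> [g1 g2] [h1 h2]; split.
  rewrite (_ : (fun _ => _) = (fun t => complex.Re (g t) * complex.Re (h t) -
      complex.Im (g t) * complex.Im (h t))).
    by apply: measurable_funB; exact: measurable_funM.
  by apply/funext => t; case: (g t) => ? ?; case: (h t).
rewrite (_ : (fun _ => _) = (fun t => complex.Re (g t) * complex.Im (h t) +
    complex.Im (g t) * complex.Re (h t))).
  by apply: measurable_funD; exact: measurable_funM.
by apply/funext => t; case: (g t) => ? ?; case: (h t).
Qed.

Lemma cmeasurableX {R : realType} (D : set R) (g : R -> R[i]) n :
  cmeasurable_fun D g -> cmeasurable_fun D (fun t => g t ^+ n).
Proof.
move=> mg; elim: n => [|n IH]; first exact: cmeasurable_cst.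
rewrite (_ : (fun _ => _) = (fun t => g t * g t ^+ n)); first exact: cmeasurableM.
by apply/funext => t; rewrite exprS.
Qed.

(** The inverse is the conjugate over the squared modulus. The latter is inverted by the real power
    [-1], which is measurable and agrees with the inverse at 0 as well. *)
Lemma cmeasurableV {R : realType} (D : set R) (g : R -> R[i]) :
  cmeasurable_fun D g -> cmeasurable_fun D (fun t => (g t)^-1).
Proof.
move=> [g1 g2].
have mN : measurable_fun D (fun t =>
    (complex.Re (g t) ^+ 2 + complex.Im (g t) ^+ 2) `^ (- 1)).
  apply: (measurableT_comp (measurable_powR (- 1))).
  by apply: measurable_funD; exact: measurable_funX.
split.
  rewrite (_ : (fun _ => _) = (fun t => complex.Re (g t) *
    (complex.Re (g t) ^+ 2 + complex.Im (g t) ^+ 2) `^ (- 1))).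
    exact: measurable_funM.
  apply/funext => t; rewrite powR_inv1 ?addr_ge0 ?sqr_ge0//.
  by case: (g t).
rewrite (_ : (fun _ => _) = (fun t => 0 - complex.Im (g t) *
    (complex.Re (g t) ^+ 2 + complex.Im (g t) ^+ 2) `^ (- 1))).
  by apply: measurable_funB => //; exact: measurable_funM.
apply/funext => t; rewrite powR_inv1 ?addr_ge0 ?sqr_ge0// sub0r.
by case: (g t).
Qed.

(** Continuity yields measurability on an open set, so the argument runs on the open diameter []-1,
    1[] and is then restricted. *)
Lemma cmeasurable_holo {R : realType} (f : R[i] -> R[i]) : holo f ->
  cmeasurable_fun `[0, 1[%classic (fun t : R => f t%:C%C).
Proof.
move=> hf.
have key (p : R[i] -> R) : (forall z w, `|p z - p w| <= cmod (z - w)) ->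
    measurable_fun (`[0, 1[%classic : set R) (fun t : R => p (f t%:C%C)).
  move=> hp; apply: (@measurable_funS _ _ _ _ (`]-1, 1[%classic : set R)).
  - exact: measurable_itv.
  - move=> t /=; rewrite !in_itv/= => /andP[t0 ->]; rewrite andbT.
    exact: lt_le_trans t0.
  - apply: open_continuous_measurable_fun; first exact: interval_open.
    move=> t; rewrite inE /= in_itv/= => t1.
    by apply: (holo_continuous_real f p t hp hf); rewrite ltr_norml.
split; apply: key => z w.
  rewrite (_ : _ - _ = complex.Re (z - w)); first exact: Re_le_cmod.
  by case: z => ? ?; case: w.
rewrite (_ : _ - _ = complex.Im (z - w)); first exact: Im_le_cmod.
by case: z => ? ?; case: w.
Qed.

Lemma cmeasurable_integrand {R : realType} (f : R[i] -> R[i]) (z : R[i]) :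
  holo f -> cmeasurable_fun `[0, 1[%classic (integrand f z).
Proof.
move=> hf; apply: cmeasurableM; first exact: cmeasurable_holo.
apply: cmeasurableV; apply: cmeasurableB; first exact: cmeasurable_cst.
by apply: cmeasurableM; [exact: cmeasurable_real|exact: cmeasurable_cst].
Qed.

Section ComplexIntegral.
Context {R : realType} (mu : {measure set R -> \bar R}).
Implicit Types (g : R -> R[i]) (h : R -> R).

Let mD : measurable (`[0, 1[%classic : set R) := measurable_itv _.

(* The factor [2] comes from bounding real and imaginary parts separately. *)
Lemma cintegral_dominated g h (B : R) :
  cmeasurable_fun `[0, 1[%classic g ->
  measurable_fun (`[0, 1[%classic : set R) h ->
  (forall t, 0 <= t -> t < 1 -> cmod (g t) <= h t) ->
  (\int[mu]_(t in `[0%R, 1%R[) (h t)%:E <= B%:E)%E ->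
  cintegrable mu g /\ cmod (cintegral mu g) <= 2 * B.
Proof.
move=> [mg1 mg2] mh gh hB.
have h0 (t : R) : `[0, 1[%classic t -> 0 <= h t.
  rewrite /= in_itv/= => /andP[t0 t1].
  exact: le_trans (cmod_ge0 _) (gh t t0 t1).
have ih : mu.-integrable (`[0, 1[%classic : set R) (EFin \o h).
  apply/integrableP; split; first exact/measurable_EFinP.
  apply: (@le_lt_trans _ _ B%:E); last exact: ltry.
  rewrite (eq_integral (fun t => (h t)%:E))// => t /set_mem th.
  by rewrite /= ger0_norm// h0.
have key (p : R[i] -> R) : (forall z, `|p z| <= cmod z) ->
    measurable_fun (`[0, 1[%classic : set R) (fun t => p (g t)) ->
    mu.-integrable (`[0, 1[%classic : set R) (EFin \o (fun t => p (g t))) /\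
    `|\int[mu]_(t in `[0, 1[) p (g t)| <= B.
  move=> hp mp.
  have ip : mu.-integrable (`[0, 1[%classic : set R) (EFin \o (fun t => p (g t))).
    apply: le_integrable ih => //; first exact/measurable_EFinP.
    move=> t Dt; rewrite /= lee_fin [leRHS]ger0_norm ?h0//.
    move: Dt; rewrite /= in_itv/= => /andP[t0 t1].
    exact: le_trans (hp _) (gh t t0 t1).
  split=> //; apply: le_trans (le_normr_Rintegral mD ip) _.
  rewrite -lee_fin; apply: le_trans hB.
  rewrite /Rintegral fineK; last first.
    by apply: integrable_fin_num => //; exact: integrable_norm ip.
  apply: ge0_le_integral => //.
  - by apply/measurable_EFinP; exact: measurableT_comp.
  - exact/measurable_EFinP.
  - move=> t /=; rewrite in_itv/= => /andP[t0 t1].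
    by rewrite lee_fin; exact: le_trans (hp _) (gh t t0 t1).
have [i1 b1] := key _ Re_le_cmod mg1.
have [i2 b2] := key _ Im_le_cmod mg2.
split=> //; apply: le_trans (cmod_le_ReIm _) _.
by rewrite mulrC mulr2n mulrDr mulr1; exact: lerD.
Qed.

Lemma cintegrableB g1 g2 : cintegrable mu g1 -> cintegrable mu g2 ->
  cintegrable mu (fun t => g1 t - g2 t) /\
  cintegral mu (fun t => g1 t - g2 t) = cintegral mu g1 - cintegral mu g2.
Proof.
move=> [r1 j1] [r2 j2].
have eR : (fun t => complex.Re (g1 t - g2 t)) =
    (fun t => complex.Re (g1 t) - complex.Re (g2 t)).
  by apply/funext => t; case: (g1 t) => ? ?; case: (g2 t).
have eI : (fun t => complex.Im (g1 t - g2 t)) =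
    (fun t => complex.Im (g1 t) - complex.Im (g2 t)).
  by apply/funext => t; case: (g1 t) => ? ?; case: (g2 t).
split; first split.
- by rewrite eR; exact: (integrableB mD r1 r2).
- by rewrite eI; exact: (integrableB mD j1 j2).
- rewrite /cintegral eR eI !RintegralB//.
Qed.

Lemma cintegrableZ (c : R[i]) g : cintegrable mu g ->
  cintegrable mu (fun t => c * g t) /\
  cintegral mu (fun t => c * g t) = c * cintegral mu g.
Proof.
move=> [r j]; case: c => a b.
have eR : (fun t => complex.Re ((a +i* b)%C * g t)) =
    (fun t => a * complex.Re (g t) - b * complex.Im (g t)).
  by apply/funext => t; case: (g t).
have eI : (fun t => complex.Im ((a +i* b)%C * g t)) =
    (fun t => a * complex.Im (g t) + b * complex.Re (g t)).
  by apply/funext => t; case: (g t) => x y /=; rewrite addrC.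
have iZ (k : R) (u : R -> R) : mu.-integrable (`[0, 1[%classic : set R) (EFin \o u) ->
    mu.-integrable (`[0, 1[%classic : set R) (EFin \o (fun t => k * u t)).
  by move=> iu; exact: (integrableZl mD k iu).
split; first split.
- by rewrite eR; exact: (integrableB mD (iZ a _ r) (iZ b _ j)).
- by rewrite eI; exact: (integrableD mD (iZ a _ j) (iZ b _ r)).
- rewrite /cintegral eR eI RintegralB ?RintegralD ?RintegralZl//; try exact: iZ.
Qed.

End ComplexIntegral.

(** * Holomorphy of [Imu mu f] *)

(** The subtracted term is the derivative in [z] of [f / (1 - t z)]; the remainder shows an explicit
    factor [h], the source of the linear rate. *)
Lemma cauchy_kernel_quotient {F : fieldType} (f t z h : F) :
  h != 0 -> 1 - t * z != 0 -> 1 - t * (h + z) != 0 ->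
  h^-1 * (f / (1 - t * (h + z)) - f / (1 - t * z)) - f * t / (1 - t * z) ^+ 2 =
  h * (t ^+ 2 * f / ((1 - t * z) ^+ 2 * (1 - t * (h + z)))).
Proof. by move=> h0 a0 b0; field; rewrite h0 a0 b0. Qed.

Lemma integral_le_scale {R : realType} (mu : {measure set R -> \bar R})
    (D : set R) (h : R -> R) (c B : R) :
  measurable D -> measurable_fun D h -> (forall t, D t -> 0 <= h t) -> 0 <= c ->
  (\int[mu]_(t in D) (h t)%:E <= B%:E)%E ->
  (\int[mu]_(t in D) (c * h t)%:E <= (c * B)%:E)%E.
Proof.
move=> mD mh h0 c0 hB.
under eq_integral do rewrite EFinM.
rewrite ge0_integralZl_EFin//; last exact/measurable_EFinP.
by rewrite EFinM; apply: lee_wpmul2l.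
Qed.

Lemma radial_1Btz_gt0 {R : realType} (t : R) (z : R[i]) :
  0 <= t -> t < 1 -> cmod z < 1 -> 0 < 1 - t * cmod z.
Proof.
move=> t0 t1 z1; rewrite subr_gt0; apply: le_lt_trans z1.
by rewrite ler_piMl ?cmod_ge0// ltW.
Qed.

Lemma cmod_1Btz_gt0 {R : realType} (t : R) (z : R[i]) :
  0 <= t -> t < 1 -> cmod z < 1 -> 0 < cmod (1 - t%:C%C * z).
Proof.
by move=> t0 t1 z1; apply: lt_le_trans (cmod_1Btz_ge _ _ t0); exact: radial_1Btz_gt0.
Qed.

Lemma cmod_integrand_le {R : realType} (f : R[i] -> R[i]) (z : R[i]) (t b : R) :
  0 <= t -> t < 1 -> cmod z < 1 -> cmod (f t%:C%C) <= b ->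
  cmod (integrand f z t) <= b * (1 - t * cmod z) `^ (- 1).
Proof.
move=> t0 t1 z1 fb; have k0 := radial_1Btz_gt0 t z t0 t1 z1.
rewrite cmodM cmodV powR_inv1 ?(ltW k0)//.
apply: ler_pM; rewrite ?cmod_ge0 ?invr_ge0 ?cmod_ge0//.
by rewrite lef_pV2 ?posrE ?cmod_1Btz_gt0// cmod_1Btz_ge.
Qed.

(** The gap [r] is a parameter so that the bound serves at [z] and, with half the gap, at the
    displaced point of the difference quotient. *)
Lemma cmod_1Btz_ge_gap {R : realType} (t r : R) (z : R[i]) :
  0 <= t -> t < 1 -> cmod z <= 1 - r -> r <= cmod (1 - t%:C%C * z).
Proof.
move=> t0 t1 zr; apply: le_trans (cmod_1Btz_ge _ _ t0).
have : t * cmod z <= 1 * cmod z by rewrite ler_wpM2r ?cmod_ge0// ltW.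
lra.
Qed.

(* The difference quotient minus the candidate derivative
   [int t f(t) / (1 - t z)^2 dmu] is [O(|h|)] by [cauchy_kernel_quotient], so no
   limit theorem for integrals is needed. *)
Lemma holo_Imu {R : realType} (mu : {measure set R -> \bar R})
    (f : R[i] -> R[i]) (h : R -> R) (B : R) :
  holo f -> measurable_fun (`[0, 1[%classic : set R) h ->
  (forall t, 0 <= t -> t < 1 -> cmod (f t%:C%C) <= h t) ->
  (\int[mu]_(t in `[0%R, 1%R[) (h t)%:E <= B%:E)%E ->
  (forall z, disc z -> cintegrable mu (integrand f z)) /\ holo (Imu mu f).
Proof.
move=> hf mh fh hB.
have h0 (t : R) : 0 <= t -> t < 1 -> 0 <= h t.
  by move=> t0 t1; exact: le_trans (cmod_ge0 _) (fh t t0 t1).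
have h0' (t : R) : `[0, 1[%classic t -> 0 <= h t.
  by rewrite /= in_itv/= => /andP[]; exact: h0.
have B0 : 0 <= B.
  by rewrite -lee_fin; apply: le_trans hB; apply: integral_ge0 => t /h0'; rewrite lee_fin.
have mI (c : R) : measurable_fun (`[0, 1[%classic : set R) (fun t => c * h t).
  exact: measurable_funM.
have iI z : disc z -> cintegrable mu (integrand f z).
  rewrite /disc /mkset => z1; have r0 : 0 < 1 - cmod z by rewrite subr_gt0.
  have [] // := @cintegral_dominated R mu (integrand f z)
    (fun t => (1 - cmod z)^-1 * h t) ((1 - cmod z)^-1 * B).
  - exact: cmeasurable_integrand.
  - move=> t t0 t1; rewrite mulrC cmodM cmodV.
    apply: ler_pM; rewrite ?cmod_ge0 ?invr_ge0 ?cmod_ge0//; first exact: fh.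
    rewrite lef_pV2 ?posrE ?cmod_1Btz_gt0//.
    by apply: cmod_1Btz_ge_gap; rewrite // opprB addrCA subrr addr0.
  - by apply: integral_le_scale => //; rewrite invr_ge0 ltW.
split; [exact: iI|move=> z dz]; have z1 : cmod z < 1 := dz.
pose r := 1 - cmod z; have r0 : 0 < r by rewrite subr_gt0.
pose G t := f t%:C%C * t%:C%C / (1 - t%:C%C * z) ^+ 2.
have mG : cmeasurable_fun `[0, 1[%classic G.
  apply: cmeasurableM.
    by apply: cmeasurableM; [exact: cmeasurable_holo|exact: cmeasurable_real].
  apply: cmeasurableV; apply: cmeasurableX; apply: cmeasurableB.
    exact: cmeasurable_cst.
  by apply: cmeasurableM; [exact: cmeasurable_real|exact: cmeasurable_cst].
have rz (t : R) : 0 <= t -> t < 1 -> r <= cmod (1 - t%:C%C * z).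
  by move=> t0 t1; apply: cmod_1Btz_ge_gap; rewrite // /r opprB addrCA subrr addr0.
have iG : cintegrable mu G.
  have [] // := @cintegral_dominated R mu G
    (fun t => r ^- 2 * h t) (r ^- 2 * B) mG.
  - move=> t t0 t1; rewrite /G mulrC 2!cmodM cmodV cmodX.
    apply: ler_pM; rewrite ?mulr_ge0 ?cmod_ge0 ?invr_ge0 ?exprn_ge0 ?cmod_ge0//.
      rewrite lef_pV2 ?posrE ?exprn_gt0 ?cmod_1Btz_gt0//.
      by rewrite lerXn2r ?nnegrE ?cmod_ge0 ?(ltW r0)// rz.
    rewrite -[h t]mulr1 ler_pM ?cmod_ge0 ?fh//.
    by rewrite cmod_real ger0_norm// ltW.
  - by apply: integral_le_scale => //; rewrite invr_ge0 exprn_ge0 ?(ltW r0).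
(* Displacements shorter than [r / 2] stay at distance at least [r / 2] from the unit circle. *)
have d0 : 0 < r / 2 by rewrite divr_gt0.
(* The outer 2 is that of [cintegral_dominated]; [2 / r^3] is the inverse of [r^2 (r / 2)], the
   lower bound for the denominator of the remainder. *)
have M0 : 0 <= 2 * ((2 / r ^+ 3) * B).
  by rewrite !mulr_ge0// invr_ge0 exprn_ge0// ltW.
apply: (@derivable_of_quotient_bound R _ z (cintegral mu G) _ _ d0 M0) => k k0 kd.
have kz1 : cmod (k + z) <= 1 - r / 2.
  by apply: le_trans (cmodD _ _) _; rewrite /r in kd *; lra.
have dkz : disc (k + z) by rewrite /disc /mkset; lra.
(* Linearity merges the quotient and the candidate derivative into one integral, to which the kernel
   identity applies pointwise. *)
have [i1 <-] := cintegrableB _ _ _ (iI _ dkz) (iI _ dz).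
have [i2 <-] := cintegrableZ _ k^-1 _ i1.
have [i3 <-] := cintegrableB _ _ _ i2 iG.
rewrite (_ : 2 * _ * _ = 2 * ((cmod k * (2 / r ^+ 3)) * B)); last by ring.
apply: (cintegral_dominated _ _ (fun t => cmod k * (2 / r ^+ 3) * h t) _ _ _ _ _).2 => //.
- by case: i3 => /integrableP[/measurable_EFinP ? _] /integrableP[/measurable_EFinP].
- move=> t t0 t1; have kz0 := cmod_1Btz_gt0 t (k + z) t0 t1 dkz.
  have zz0 := cmod_1Btz_gt0 t z t0 t1 z1.
  rewrite /integrand /G cauchy_kernel_quotient -?cmod_eq0 ?gt_eqF//; last first.
    by rewrite lt_neqAle cmod_ge0 eq_sym cmod_eq0 k0.
  rewrite cmodM -[leRHS]mulrA ler_wpM2l ?cmod_ge0//.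
  rewrite (cmodM _ (_^-1)) (cmodM (_ ^+ 2)) cmodV (cmodM (_ ^+ 2)) !cmodX cmod_real ger0_norm//.
  rewrite mulrC; apply: ler_pM.
  + by rewrite invr_ge0 mulr_ge0// ?exprn_ge0 ?cmod_ge0.
  + by rewrite mulr_ge0 ?exprn_ge0 ?cmod_ge0.
  + rewrite -[2 / _]invrK lef_pV2 ?posrE ?mulr_gt0 ?exprn_gt0 ?invr_gt0 ?divr_gt0 ?exprn_gt0//.
    rewrite invf_div (_ : _ / 2 = r ^+ 2 * (r / 2)); last by ring.
    apply: ler_pM; rewrite ?exprn_ge0 ?(ltW r0) ?(ltW d0)//.
      by rewrite lerXn2r ?nnegrE ?cmod_ge0 ?(ltW r0)// rz.
    exact: cmod_1Btz_ge_gap.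
  + rewrite -[h t]mul1r ler_pM ?exprn_ge0 ?cmod_ge0 ?fh//.
    by rewrite exprn_ile1// ltW.
- apply: integral_le_scale => //.
  by rewrite mulr_ge0 ?cmod_ge0// divr_ge0// exprn_ge0// ltW.
Qed.

(** * Weighted sup norms and growth estimates *)

Lemma vw_ge0 {R : realType} (g : R) (z : R[i]) : 0 <= vw g z.
Proof. exact: powR_ge0. Qed.

Lemma wnorm_le {R : realType} (g M : R) (f : R[i] -> R[i]) :
  (forall z, disc z -> vw g z * cmod (f z) <= M) -> wnorm g f <= M.
Proof.
move=> h; apply: ge_sup => [|_ [z dz <-]]; last exact: h.
by exists (vw g 0 * cmod (f 0)); exists 0 => //; rewrite /disc /mkset cmod0.
Qed.

(** Membership in [Hinf] supplies the upper bound: the [sup] of an unbounded set is a default value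
    that dominates nothing. *)
Lemma wnorm_ge {R : realType} (g : R) (f : R[i] -> R[i]) (z : R[i]) :
  Hinf g f -> disc z -> vw g z * cmod (f z) <= wnorm g f.
Proof.
move=> [_ [M hM]] dz; apply: ub_le_sup; last by exists z.
by exists M => _ [w dw <-]; exact: hM.
Qed.

Lemma wnorm_ge0 {R : realType} (g : R) (f : R[i] -> R[i]) :
  Hinf g f -> 0 <= wnorm g f.
Proof.
move=> hf; apply: le_trans (wnorm_ge g f 0 hf _).
  by rewrite mulr_ge0 ?vw_ge0 ?cmod_ge0.
by rewrite /disc /mkset cmod0.
Qed.

Lemma holoB {R : realType} (f g : R[i] -> R[i]) :
  holo f -> holo g -> holo (f \- g).
Proof. by move=> hf hg z dz; apply: derivableB; [exact: hf|exact: hg]. Qed.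

Lemma HinfB {R : realType} (a : R) (f g : R[i] -> R[i]) :
  Hinf a f -> Hinf a g -> Hinf a (f \- g).
Proof.
move=> [hf [M hM]] [hg [N hN]]; split; first exact: holoB.
exists (M + N) => z dz; apply: le_trans (lerD (hM z dz) (hN z dz)).
rewrite -mulrDr ler_wpM2l ?vw_ge0//.
by apply: le_trans (cmodD _ _) _; rewrite cmodN.
Qed.

Lemma vw_bound_radial {R : realType} (g M : R) (f : R[i] -> R[i]) (t : R) :
  0 <= t -> t < 1 -> vw g t%:C%C * cmod (f t%:C%C) <= M ->
  cmod (f t%:C%C) <= M * (1 - t) `^ (- g).
Proof.
move=> t0 t1; rewrite /vw cmod_real ger0_norm// => h.
by rewrite powRN ler_pdivlMr ?powR_gt0 ?subr_gt0// mulrC.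
Qed.

(** Only the growth of [f] along the radius [[0, 1)] enters: it reduces the integral to the kernel
    estimate at [r = cmod z]. *)
Lemma Imu_growth {R : realType} (mu : {measure set R -> \bar R})
    (g p C M : R) (f : R[i] -> R[i]) (z : R[i]) :
  0 <= M -> holo f ->
  (forall t, 0 <= t -> t < 1 -> cmod (f t%:C%C) <= M * (1 - t) `^ (- g)) ->
  (forall r, 0 <= r -> r < 1 ->
    (\int[mu]_(t in `[0%R, 1%R[) ((1 - t) `^ (- g) * (1 - t * r) `^ (- 1))%:E <=
      (C * (1 - r) `^ (- p))%:E)%E) ->
  disc z -> vw p z * cmod (Imu mu f z) <= 2 * (M * C).
Proof.
move=> M0 hf fM hC dz.
have r0 : 0 < 1 - cmod z by rewrite subr_gt0.
rewrite /vw mulrC -ler_pdivlMr ?powR_gt0// -powRN -!mulrA.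
apply: (cintegral_dominated mu (integrand f z) (fun t => M * ((1 - t) `^ (- g) * (1 - t * cmod z) `^ (- 1))) _ _ _ _ _).2.
- exact: cmeasurable_integrand.
- by apply: measurable_funM => //; exact: measurable_powR_kernel.
- by move=> t t0 t1; rewrite mulrA cmod_integrand_le// fM.
- apply: integral_le_scale => //; first exact: measurable_powR_kernel.
    by move=> t _; rewrite mulr_ge0 ?powR_ge0.
  by apply: hC => //; exact: cmod_ge0.
Qed.

(** The radius [1 - e^(1/p)] solves [(1 - r)^p = e]. *)
Lemma vw_small {R : realType} (p e : R) : 0 < p -> 0 < e ->
  exists2 r, r < 1 & forall z : R[i], disc z -> r < cmod z -> vw p z < e.
Proof.
move=> p0 e0; pose q := e `^ p^-1; have q0 : 0 < q by rewrite powR_gt0.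
have <- : q `^ p = e by rewrite /q -powRrM mulVf ?gt_eqF// powRr1// ltW.
exists (1 - q) => [|z dz rz]; first by rewrite ltrBlDr ltrDl.
have z1 : 0 < 1 - cmod z by rewrite subr_gt0.
apply: (gt0_ltr_powR p0); rewrite ?nnegrE ?(ltW z1) ?(ltW q0)//.
by rewrite ltrBlDr -ltrBlDl.
Qed.

(** * From the Carleson condition to the operators *)

Section CarlesonImplies.
Context {R : realType} (mu : {finite_measure set R -> \bar R}) (g d K : R).
Hypotheses (g0 : 0 < g) (d1 : - g < d) (d2 : d < 1 - g) (K0 : 0 <= K).
Hypothesis hmu : global_carleson mu (1 - d) K.

Let gs : g < 1 - d. Proof. by rewrite ltrBrDr addrC -ltrBrDr. Qed.
Let sg : 1 - d < g + 1. Proof. by rewrite [g + 1]addrC ltrD2l ltrNl. Qed.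

Lemma carleson_weight_integral : exists2 C, 0 <= C &
  (\int[mu]_(t in `[0%R, 1%R[) ((1 - t) `^ (- g))%:E <= C%:E)%E.
Proof.
have [C C0 /(_ 0 ltr01)] := carleson_integral_near1 mu _ K g (ltW g0) gs K0 hmu.
by rewrite subr0 powR1 mulr1; exists C.
Qed.

Lemma carleson_weight_integrable :
  mu.-integrable `[0, 1[%classic (fun t : R => ((vw g t%:C%C)^-1)%:E).
Proof.
have [C C0 hC] := carleson_weight_integral.
have e (t : R) : t \in (`[0, 1[%classic : set R) ->
    ((1 - t) `^ (- g))%:E = ((vw g t%:C%C)^-1)%:E.
  rewrite inE /= in_itv/= => /andP[t0 t1].
  by rewrite /vw cmod_real ger0_norm// powRN.
apply: (@eq_integrable _ _ _ mu `[0, 1[%classic _ (fun t => ((1 - t) `^ (- g))%:E)) => //; apply/integrableP; split.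
  by apply/measurable_EFinP; exact: measurable_powR_1B.
apply: le_lt_trans (ltry C); apply: le_trans hC.
by under eq_integral do rewrite /= ger0_norm ?powR_ge0//.
Qed.

Lemma carleson_kernel : exists2 C, 0 <= C & forall r, 0 <= r -> r < 1 ->
  (\int[mu]_(t in `[0%R, 1%R[) ((1 - t) `^ (- g) * (1 - t * r) `^ (- 1))%:E <=
    (C * (1 - r) `^ (- (g + d)))%:E)%E.
Proof.
have [C C0 hC] := carleson_kernel_integral mu _ K g (ltW g0) gs sg K0 hmu.
exists C => // r r0 r1; rewrite (_ : - (g + d) = 1 - d - g - 1); last by ring.
exact: hC.
Qed.

Lemma carleson_Imu_holo f : Hinf g f ->
  (forall z, disc z -> cintegrable mu (integrand f z)) /\ holo (Imu mu f).
Proof.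
move=> [hf [M hM]]; have [C C0 hC] := carleson_weight_integral.
have M0 : 0 <= M.
  have /hM : disc (0 : R[i]) by rewrite /disc /mkset cmod0.
  by apply: le_trans; rewrite mulr_ge0 ?vw_ge0 ?cmod_ge0.
apply: (@holo_Imu _ _ _ (fun t => M * (1 - t) `^ (- g)) (M * C)) => //.
- by apply: measurable_funM => //; exact: measurable_powR_1B.
- move=> t t0 t1; apply: vw_bound_radial => //; apply: hM.
  by rewrite /disc /mkset cmod_real ger0_norm.
- apply: integral_le_scale => //; first exact: measurable_powR_1B.
  by move=> t _; exact: powR_ge0.
Qed.

(** [C] is fixed before [f], and the norm of [f] appears as a factor, as continuity requires. *)
Lemma carleson_Imu_bounded : exists2 C, 0 <= C & forall f z, Hinf g f ->
  disc z -> vw (g + d) z * cmod (Imu mu f z) <= 2 * (wnorm g f * C).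
Proof.
have [C C0 hC] := carleson_kernel; exists C => // f z hf dz.
apply: (@Imu_growth _ _ g) => //; first exact: wnorm_ge0.
- by case: hf.
- move=> t t0 t1; apply: vw_bound_radial => //; apply: wnorm_ge => //.
  by rewrite /disc /mkset cmod_real ger0_norm.
Qed.

Lemma carleson_Imu_Hinf f : Hinf g f -> Hinf (g + d) (Imu mu f).
Proof.
move=> hf; split; first by have [] := carleson_Imu_holo _ hf.
have [C C0 hC] := carleson_Imu_bounded.
by exists (2 * (wnorm g f * C)) => z; exact: hC.
Qed.

(** The spaces are left abstract so that one argument covers [Hinf] and [H0]: by linearity,
    continuity reduces to the uniform bound for the difference of two functions. *)
Lemma carleson_Imu_continuous (X : R -> (R[i] -> R[i]) -> Prop)
    (Y : R -> (R[i] -> R[i]) -> Prop) :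
  (forall f, X g f -> Hinf g f) -> (forall f, X g f -> Y (g + d) (Imu mu f)) ->
  wd_cont_op mu X g Y (g + d).
Proof.
move=> XH XY; split => [f Xf|f /XH hf eps eps0].
  by split; [have [] := carleson_Imu_holo _ (XH _ Xf)|exact: XY].
have [C C0 hC] := carleson_Imu_bounded.
have C1 : 0 < 2 * C + 1 by rewrite ltr_wpDl// mulr_ge0.
exists (eps / (2 * C + 1)); split; first by rewrite divr_gt0.
move=> u /XH hu hn; have huf := HinfB _ _ _ hu hf.
apply: (@le_lt_trans _ _ (2 * (wnorm g (u \- f) * C))).
  apply: wnorm_le => z dz.
  rewrite (_ : (Imu mu u \- Imu mu f) z = Imu mu (u \- f) z); first exact: hC.
  have [iu _] := carleson_Imu_holo _ hu; have [jf _] := carleson_Imu_holo _ hf.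
  have [_ /= <-] := cintegrableB mu _ _ (iu z dz) (jf z dz).
  by congr cintegral; apply/funext => t; rewrite /integrand /= mulrBl.
have w0 := wnorm_ge0 _ _ huf.
rewrite ltr_pdivlMr// in hn; apply: le_lt_trans hn.
by rewrite mulrDr mulr1 mulrCA lerDl.
Qed.

(* On [0, r1] the integrand stays bounded as |z| -> 1, and the rest of the
   integral carries the small factor of f. *)
Lemma carleson_Imu_H0 f : H0 g f -> H0 (g + d) (Imu mu f).
Proof.
move=> [hf f0]; split=> [|eps eps0]; first exact: carleson_Imu_Hinf.
have [C C0 hC] := carleson_kernel.
(* Chosen so that the part of the integral beyond [r1] contributes [2 * e1 * C < eps / 2] to the
   weighted value. *)
pose e1 := eps / (4 * (C + 1)).
have C1 : 0 < 4 * (C + 1) by rewrite mulr_gt0// ltr_wpDl.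
have e10 : 0 < e1 by rewrite divr_gt0.
have [r0 [r01 hr0]] := f0 e1 e10.
pose r1 := Num.max r0 0; have r10 : 0 <= r1 by rewrite le_max lexx orbT.
have r11 : r1 < 1 by rewrite gt_max r01 ltr01.
have p0 : 0 < g + d by rewrite -ltrBlDl sub0r.
have w0 := wnorm_ge0 _ _ hf.
have r1s : 0 < 1 - r1 by rewrite subr_gt0.
(* For [t <= r1] the integrand is at most [b]: the norm controls [f] there, and
   [1 - t |z| >= 1 - r1]. Hence [N] bounds this part for every [z]. *)
pose b := wnorm g f * (1 - r1) `^ (- g) * (1 - r1)^-1.
have b0 : 0 <= b by rewrite !mulr_ge0 ?powR_ge0 ?invr_ge0 ?(ltW r1s).
pose N := b * fine (mu `[0, 1[%classic).
have N0 : 0 <= N by rewrite mulr_ge0// fine_ge0.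
have N1 : 0 < 4 * (N + 1) by rewrite mulr_gt0// ltr_wpDl.
(* Near the circle the weight, which has positive exponent [g + d], brings the contribution [2 * N]
   below [eps / 2]. *)
have [r2 r21 hr2] := vw_small _ _ p0 (divr_gt0 eps0 N1).
exists r2; split=> // z dz rz; have vz := hr2 z dz rz.
have z1 : 0 < 1 - cmod z by rewrite subr_gt0.
have hI : cmod (Imu mu f z) <=
    2 * (e1 * (C * (1 - cmod z) `^ (- (g + d))) + N).
  (* Instead of splitting the integral, the dominating function is a sum: [b] is enough up to [r1]
     and the kernel term beyond it. *)
  apply: (cintegral_dominated mu (integrand f z) (fun t =>
    e1 * ((1 - t) `^ (- g) * (1 - t * cmod z) `^ (- 1)) + b) _ _ _ _ _).2.
  - by apply: cmeasurable_integrand; case: hf.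
  - apply: measurable_funD => //.
    by apply: measurable_funM => //; exact: measurable_powR_kernel.
  - move=> t t0 t1; have dt : disc (t%:C%C : R[i]).
      by rewrite /disc /mkset cmod_real ger0_norm.
    have [tr|tr] := leP t r1.
      apply: (@le_trans _ _ b); last first.
        rewrite lerDr; apply: mulr_ge0; first exact: ltW.
        by rewrite mulr_ge0 ?powR_ge0.
      rewrite cmodM cmodV; apply: ler_pM; rewrite ?cmod_ge0 ?invr_ge0 ?cmod_ge0//.
        apply: le_trans (vw_bound_radial g _ f t t0 t1 (wnorm_ge _ _ _ hf dt)) _.
        rewrite ler_wpM2l// !powRN lef_pV2 ?posrE ?powR_gt0 ?subr_gt0//.
        by rewrite ge0_ler_powR ?nnegrE ?subr_ge0 ?(ltW g0) ?(ltW t1) ?(ltW r11)// lerB.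
      rewrite lef_pV2 ?posrE// ?cmod_1Btz_gt0//.
      apply: le_trans (cmod_1Btz_ge _ _ t0); rewrite lerB//.
      by apply: le_trans tr; rewrite ler_piMr// ltW.
    apply: (@le_trans _ _ (e1 * ((1 - t) `^ (- g) * (1 - t * cmod z) `^ (- 1)))).
      rewrite mulrA; apply: cmod_integrand_le => //; apply: vw_bound_radial => //.
      apply/ltW/hr0 => //; rewrite cmod_real ger0_norm//.
      by apply: le_lt_trans tr; rewrite le_max lexx.
    by rewrite lerDl.
  - under eq_integral do rewrite EFinD.
    rewrite ge0_integralD//; last 2 first.
    + move=> t _; rewrite lee_fin; apply: mulr_ge0; first exact: ltW.
      by rewrite mulr_ge0 ?powR_ge0.
    + by apply/measurable_EFinP; apply: measurable_funM => //; exact: measurable_powR_kernel.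

    rewrite EFinD; apply: leeD.
      apply: integral_le_scale; rewrite ?(ltW e10)//; first exact: measurable_powR_kernel.
        by move=> t _; rewrite mulr_ge0 ?powR_ge0.
      by apply: hC => //; exact: cmod_ge0.
    apply: (@le_trans _ _ (b%:E * (fine (mu `[0%R, 1%R[%classic))%:E)%E); last first.
      by rewrite -EFinM.
    by rewrite integral_cst// fineK//; exact: fin_num_measure.
apply: le_lt_trans (ler_wpM2l (vw_ge0 _ _) hI) _.
have vv : vw (g + d) z * (1 - cmod z) `^ (- (g + d)) = 1.
  by rewrite /vw powRN divff// gt_eqF// powR_gt0.
rewrite [ltLHS](_ : _ = 2 * (e1 * C) * (vw (g + d) z * (1 - cmod z) `^ (- (g + d)))
  + 2 * (vw (g + d) z * N)); last by ring.
rewrite vv mulr1.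
have h1 : e1 * (C + 1) = eps / 4 by rewrite /e1; field; rewrite gt_eqF// ltr_wpDl.
have h2 : vw (g + d) z * (N + 1) < eps / 4.
  move: vz; rewrite invfM mulrA ltr_pdivlMr// ltr_wpDl//.
have := vw_ge0 (g + d) z.
lra.
Qed.

End CarlesonImplies.

(** * Test functions *)

(* An integer exponent [m] replaces [gamma], so that no complex power is needed. *)
Definition test_fun {R : realType} (c a : R) (m : nat) (z : R[i]) : R[i] :=
  c%:C%C / (1 - a%:C%C * z) ^+ m.

Lemma test_fun_holo {R : realType} (c a : R) m : 0 <= a -> a < 1 ->
  holo (test_fun c a m).
Proof.
move=> a0 a1 z dz.
have h1 : derivable ((fun z => 1 - a%:C%C * z) : R[i]^o -> R[i]^o) z 1.
  apply: derivableB; first exact: derivable_cst.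
  by apply: derivableZ; exact: derivable_id.
have n0 : 1 - a%:C%C * z != 0 by rewrite -cmod_eq0 gt_eqF// cmod_1Btz_gt0.
have h2 := derivableV n0 h1.
elim: m => [|m IH].
  rewrite (_ : test_fun _ _ _ = fun=> c%:C%C); first exact: derivable_cst.
  by apply/funext => w; rewrite /test_fun expr0 divr1.
rewrite (_ : test_fun c a m.+1 = fun w => test_fun c a m w * (1 - a%:C%C * w)^-1).
  exact: (derivableM IH h2).
by apply/funext => w; rewrite /test_fun exprSr invfM mulrA.
Qed.

Lemma cmod_test_fun_le {R : realType} (c a : R) m (z : R[i]) :
  0 <= c -> 0 <= a -> a < 1 -> disc z ->
  cmod (test_fun c a m z) <= c / (1 - a * cmod z) ^+ m.
Proof.
move=> c0 a0 a1 dz; have u0 := radial_1Btz_gt0 a z a0 a1 dz.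
rewrite cmodM cmodV cmodX cmod_real ger0_norm// ler_wpM2l//.
rewrite lef_pV2 ?posrE ?exprn_gt0 ?cmod_1Btz_gt0//.
by rewrite lerXn2r ?nnegrE ?cmod_ge0 ?(ltW u0)// cmod_1Btz_ge.
Qed.

(** Both [1 - |z|] and [1 - a] are at most [u = 1 - a |z|]; replacing each by [u] is allowed since
    [0 < g <= m], and then all powers of [u] cancel. The bound does not depend on [a]. *)
Lemma test_fun_bounded {R : realType} (e a g : R) m (z : R[i]) :
  0 <= e -> 0 <= a -> a < 1 -> 0 < g -> g <= m%:R -> disc z ->
  vw g z * cmod (test_fun (e * (1 - a) `^ (m%:R - g)) a m z) <= e.
Proof.
move=> e0 a0 a1 g0 gm dz; have u0 := radial_1Btz_gt0 a z a0 a1 dz.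
have a10 : 0 < 1 - a by rewrite subr_gt0.
have z10 : 0 < 1 - cmod z by rewrite subr_gt0.
set u := 1 - a * cmod z in u0.
have c0 : 0 <= e * (1 - a) `^ (m%:R - g) by rewrite mulr_ge0 ?powR_ge0.
apply: (@le_trans _ _ (u `^ g * (e * u `^ (m%:R - g) / u ^+ m))).
  apply: ler_pM; rewrite ?vw_ge0 ?cmod_ge0//.
    rewrite /vw ge0_ler_powR ?nnegrE ?(ltW g0) ?(ltW z10) ?(ltW u0)//.
    by rewrite /u lerB// ler_piMl ?cmod_ge0// ltW.
  apply: (le_trans (cmod_test_fun_le _ _ _ _ c0 a0 a1 dz)).
  rewrite ler_wpM2r ?invr_ge0 ?exprn_ge0 ?(ltW u0)// ler_wpM2l//.
  have mg : 0 <= m%:R - g by rewrite subr_ge0.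
  rewrite ge0_ler_powR ?nnegrE ?(ltW a10) ?(ltW u0)//.
  by rewrite /u lerB// ler_piMr// ltW.
rewrite mulrA mulrCA -powRD ?(gt_eqF u0) ?implybT// addrC subrK.
by rewrite powR_mulrn ?(ltW u0)// mulfK// expf_neq0// gt_eqF.
Qed.

(** For fixed [a < 1] the function is bounded on the whole disc by [c / (1 - a)^m], so the weight
    forces decay at the circle. *)
Lemma test_fun_H0 {R : realType} (e a g : R) m :
  0 <= e -> 0 <= a -> a < 1 -> 0 < g -> g <= m%:R ->
  H0 g (test_fun (e * (1 - a) `^ (m%:R - g)) a m).
Proof.
move=> e0 a0 a1 g0 gm; set c := e * _.
have c0 : 0 <= c by rewrite mulr_ge0 ?powR_ge0.
have a10 : 0 < 1 - a by rewrite subr_gt0.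
split.
  split; first exact: test_fun_holo.
  by exists e => z dz; exact: test_fun_bounded.
move=> eps eps0; pose A := c / (1 - a) ^+ m.
have A0 : 0 <= A by rewrite divr_ge0// exprn_ge0// ltW.
have A1 : 0 < A + 1 by rewrite ltr_wpDl.
have [r r1 hr] := vw_small _ _ g0 (divr_gt0 eps0 A1).
exists r; split=> // z dz rz.
have := hr z dz rz; rewrite ltr_pdivlMr//; apply: le_lt_trans.
rewrite ler_wpM2l ?vw_ge0//; apply: (@le_trans _ _ A); last by rewrite lerDl.
have u0 := radial_1Btz_gt0 a z a0 a1 dz.
apply: (le_trans (cmod_test_fun_le _ _ _ _ c0 a0 a1 dz)); rewrite ler_wpM2l//.
rewrite lef_pV2 ?posrE ?exprn_gt0// lerXn2r ?nnegrE ?(ltW u0) ?(ltW a10)//.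
by rewrite lerB// ler_piMr// ltW.
Qed.

(** * From the operators to the Carleson condition *)

Lemma Imu0 {R : realType} (mu : {measure set R -> \bar R}) (z : R[i]) :
  Imu mu (fun=> 0) z = 0.
Proof.
rewrite /Imu (_ : integrand _ z = fun=> 0); last first.
  by apply/funext => t; rewrite /integrand mul0r.
by rewrite /cintegral /= !Rintegral_cst// !mul0r.
Qed.

Lemma integrand_test_fun {R : realType} (c a t : R) m :
  integrand (test_fun c a m) a%:C%C t = (c / (1 - t * a) ^+ m.+1)%:C%C.
Proof.
rewrite /integrand /test_fun.
rewrite exprSr !(rmorphM, fmorphV, rmorphXn, rmorphB, rmorph1) /=.
by rewrite invfM mulrA [a%:C%C * _]mulrC.
Qed.

(** At [z = a] the integrand is real and nonnegative, and for [t >= a] one has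
    [1 - t a <= 1 - a^2 <= 2 (1 - a)]. *)
Lemma Imu_test_fun_ge {R : realType} (mu : {measure set R -> \bar R})
    (c a : R) m : 0 <= c -> 0 <= a -> a < 1 ->
  cintegrable mu (integrand (test_fun c a m) a%:C%C) ->
  ((c / (2 * (1 - a)) ^+ m.+1)%:E * mu `[a, 1%R[%classic <=
    (cmod (Imu mu (test_fun c a m) a%:C%C))%:E)%E.
Proof.
move=> c0 a0 a1 [iR _].
have a10 : 0 < 1 - a by rewrite subr_gt0.
apply: (@le_trans _ _ (\int[mu]_(t in `[0%R, 1%R[) (c / (1 - t * a) ^+ m.+1)%:E)%E).
  have k0 (t : R) : 0 <= t -> t < 1 -> 0 < 1 - t * a.
    move=> t0 t1; rewrite subr_gt0; apply: le_lt_trans t1.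
    by rewrite ler_piMr// ltW.
  apply: ge0_integral_ge_cst => //.
  - by move=> t /=; rewrite !in_itv/= => /andP[ta ->]; rewrite (le_trans a0).
  - case/integrableP: iR => /measurable_EFinP + _.
    by rewrite (_ : (fun _ => _) = fun t => c / (1 - t * a) ^+ m.+1);
      [move/measurable_EFinP|apply/funext => t; rewrite integrand_test_fun].
  - move=> t /=; rewrite in_itv/= => /andP[t0 t1].
    by rewrite lee_fin divr_ge0// exprn_ge0// ltW// k0.
  - by rewrite divr_ge0// exprn_ge0// mulr_ge0// ltW.
  - move=> t /=; rewrite in_itv/= => /andP[ta t1].
    have t0 := le_trans a0 ta.
    rewrite lee_fin ler_wpM2l// lef_pV2 ?posrE ?exprn_gt0 ?mulr_gt0 ?k0//.
    rewrite lerXn2r ?nnegrE ?mulr_ge0 ?(ltW a10) ?(ltW (k0 _ t0 t1))//.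
    have : a * a <= t * a by rewrite ler_wpM2r.
    have : 0 <= (1 - a) * (1 - a) by rewrite mulr_ge0 ?(ltW a10).
    lra.
apply: (@le_trans _ _ (complex.Re (Imu mu (test_fun c a m) a%:C%C))%:E).
  rewrite /Imu /cintegral /= /Rintegral fineK; last exact: integrable_fin_num.
  by under [leRHS]eq_integral do rewrite integrand_test_fun.
by rewrite lee_fin; apply: le_trans (Re_le_cmod _); exact: ler_norm.
Qed.

(** The test functions lie in [H0], so any [X] containing [H0] and any [Y] inside [Hinf] will do.
    Continuity at 0 bounds the norm of the image of a small test function, and that bound is read at
    the point [a]. *)
Lemma wd_cont_op_carleson {R : realType} (mu : {measure set R -> \bar R})
    (X Y : R -> (R[i] -> R[i]) -> Prop) (g d : R) : 0 < g ->
  (forall f, H0 g f -> X g f) -> (forall f, Y (g + d) f -> Hinf (g + d) f) ->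
  wd_cont_op mu X g Y (g + d) -> carleson mu (1 - d).
Proof.
move=> g0 HX YH [wd cont].
pose m := (Num.trunc g).+1.
have gm : g <= m%:R by have /andP[_ /ltW] := Num.Theory.truncn_itv (ltW g0).
have X0 : X g (fun=> 0).
  (* The zero function is the test function with coefficient 0. *)
  apply: HX; have := test_fun_H0 0 0 g m (lexx _) (lexx _) ltr01 g0 gm.
  rewrite (_ : test_fun _ _ _ = fun=> 0)//.
  by apply/funext => z; rewrite /test_fun mul0r mul0r.
have [eta [eta0 heta]] := cont _ X0 1 ltr01.
(* The test functions have norm at most [e], while continuity asks for norm strictly below [eta]. *)
pose e := eta / 2; have e0 : 0 < e by rewrite divr_gt0.
exists (2 ^+ m.+1 / e), 0; split=> // a a0 a1.
have a10 : 0 < 1 - a by rewrite subr_gt0.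
pose c := e * (1 - a) `^ (m%:R - g).
have c0 : 0 < c by rewrite mulr_gt0 ?powR_gt0.
pose f := test_fun c a m.
have Xf : X g f by apply: HX; apply: test_fun_H0 => //; exact: ltW.
have [iif Yf] := wd _ Xf; have [_ Y0] := wd _ X0.
have da : disc (a%:C%C : R[i]) by rewrite /disc /mkset cmod_real ger0_norm.
have fe : wnorm g (f \- (fun=> 0)) < eta.
  apply: (@le_lt_trans _ _ e); last by rewrite /e ltr_pdivrMr// ltr_pMr// ltr1n.
  by apply: wnorm_le => z dz; rewrite /= subr0; apply: test_fun_bounded => //; exact: ltW.
have := le_lt_trans (wnorm_ge _ _ _ (HinfB _ _ _ (YH _ Yf) (YH _ Y0)) da) (heta _ Xf fe).
rewrite [X in _ * cmod X](_ : _ = Imu mu f a%:C%C - Imu mu (fun=> 0) a%:C%C)//.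
rewrite Imu0 subr0 /vw cmod_real ger0_norm// => hI.
have p0 : 0 < (1 - a) `^ (g + d) by rewrite powR_gt0.
have h : ((c / (2 * (1 - a)) ^+ m.+1)%:E * mu `[a, 1%R[%classic <=
    ((1 - a) `^ (- (g + d)))%:E)%E.
  apply: le_trans (Imu_test_fun_ge mu c a m (ltW c0) a0 a1 (iif _ da)) _.
  by rewrite lee_fin powRN -[leRHS]mul1r ler_pdivlMr// mulrC ltW.
have k0 : 0 < c / (2 * (1 - a)) ^+ m.+1.
  by rewrite divr_gt0// exprn_gt0// mulr_gt0.
move: h; rewrite -lee_pdivlMl// => /le_trans; apply.
rewrite -EFinM lee_fin le_eqVlt; apply/predU1P; left.
rewrite invf_div /c exprMn.
(* The exponents add up: [(m + 1) - (m - g) - (g + d) = 1 - d]. *)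
have -> : (1 - a) `^ (1 - d) = (1 - a) ^+ m.+1 / (1 - a) `^ (m%:R - g) * (1 - a) `^ (- (g + d)).
  rewrite -powR_mulrn ?(ltW a10)// -powRN -!powRD ?(gt_eqF a10) ?implybT//.
  by congr (_ `^ _); rewrite -natr1; ring.
field.
by rewrite !gt_eqF// powR_gt0.
Qed.

(** * The equivalences, assembled *)

Theorem theorem16 (R : realType) (mu : {finite_measure set R -> \bar R})
  (supp : mu (~` `[0%R, 1%R[) = 0%E)
  (gamma delta : R) (hgamma : 0 < gamma)
  (hdelta1 : - gamma < delta) (hdelta2 : delta < 1 - gamma) :
  let i_ := wd_cont_op mu (@Hinf R) gamma (@Hinf R) (gamma + delta) in
  let ii_ := wd_cont_op mu (@H0 R) gamma (@H0 R) (gamma + delta) /\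
             mu.-integrable `[0%R, 1%R[
               (fun t : R => ((vw gamma (t%:C)%C)^-1)%:E) in
  let iii_ := carleson mu (1 - delta) in
  let iv_ := exists K : R, exists N : nat, forall n : nat, (N <= n)%N ->
               (`|moment mu n| <= (K / (n%:R `^ (1 - delta)))%:E)%E in
  [/\ i_ <-> ii_, ii_ <-> iii_ & iii_ <-> iv_].
Proof.
have s0 : 0 < 1 - delta by rewrite subr_gt0; lra.
have i_iii : wd_cont_op mu (@Hinf R) gamma (@Hinf R) (gamma + delta) ->
    carleson mu (1 - delta).
  by apply: wd_cont_op_carleson => // f [].
have ii_iii : wd_cont_op mu (@H0 R) gamma (@H0 R) (gamma + delta) ->
    carleson mu (1 - delta).
  by apply: wd_cont_op_carleson => // f [].
have iii_i : carleson mu (1 - delta) ->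
    wd_cont_op mu (@Hinf R) gamma (@Hinf R) (gamma + delta).
  move=> /(carleson_global mu _ s0)[K K0 hK].
  apply: (carleson_Imu_continuous mu gamma delta K) => // f.
  exact: (carleson_Imu_Hinf mu gamma delta K).
have iii_ii : carleson mu (1 - delta) ->
    wd_cont_op mu (@H0 R) gamma (@H0 R) (gamma + delta) /\
    mu.-integrable `[0%R, 1%R[ (fun t : R => ((vw gamma (t%:C)%C)^-1)%:E).
  move=> /(carleson_global mu _ s0)[K K0 hK]; split.
    apply: (carleson_Imu_continuous mu gamma delta K) => // f; first by case.
    exact: (carleson_Imu_H0 mu gamma delta K).
  exact: (carleson_weight_integrable mu gamma delta K).
(* The two operator statements are linked through the Carleson condition. *)
split; split.
- by move=> /i_iii/iii_ii.
- by case=> /ii_iii/iii_i.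
- by case=> /ii_iii.
- by move=> /iii_ii.
- exact: carleson_moment.
- exact: moment_carleson.
Qed.
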